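(* Let $G$ be a finite non-cyclic group whose non-cyclic graph $\Gamma_G$ has two kind degrees. Then $G$ is abelian if and only if $G\cong \mathbb{Z}_m\oplus\big(\bigoplus_{i=1}^n \mathbb{Z}_{p^2}\big)$ for some prime number $p$, some integer $n>1$ and some positive integer $m$ with $\gcd(m,p)=1$.
   Context: For a group $G$, $Cyc(G)=\{x\in G : \langle x,y\rangle \text{ is cyclic for all } y\in G\}$. For a finite non-cyclic group $G$, the non-cyclic graph $\Gamma_G$ is the simple graph with vertex set $G\setminus Cyc(G)$ in which two distinct vertices $x,y$ are adjacent if and only if $\langle x,y\rangle$ is not cyclic. A simple graph has $k$ kind degrees if the set of degrees of its vertices has exactly $k$ elements. $\mathbb{Z}_k$ denotes the cyclic group of order $k$. *)

(* Defs.v *)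
From mathcomp Require Import all_boot all_order all_fingroup all_algebra all_solvable.

Set Implicit Arguments.
Unset Strict Implicit.
Unset Printing Implicit Defensive.

Local Open Scope group_scope.

(* A finite simple graph is given by its vertex set V and a symmetric
   irreflexive relation e, of which only the restriction to V matters. *)
Definition vdegree (T : finType) (V : {set T}) (e : rel T) (x : T) : nat :=
  #|[set y in V | e x y]|.

Definition has_kind_degrees (T : finType) (V : {set T}) (e : rel T) (k : nat)
  : Prop :=
  size (undup [seq vdegree V e x | x in V]) = k.

Definition Cyc (gT : finGroupType) (G : {set gT}) : {set gT} :=
  [set x in G | [forall y in G, cyclic <<[set x; y]>>]].

Definition noncyc_vertices (gT : finGroupType) (G : {set gT}) : {set gT} :=
  G :\: Cyc G.

Definition noncyc_adj (gT : finGroupType) : rel gT :=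
  fun x y => (x != y) && ~~ cyclic <<[set x; y]>>.

Arguments noncyc_adj {gT}.

Lemma noncyc_adj_sym (gT : finGroupType) : symmetric (@noncyc_adj gT).
Proof. by move=> x y; rewrite /noncyc_adj eq_sym setUC. Qed.

Lemma noncyc_adj_irr (gT : finGroupType) : irreflexive (@noncyc_adj gT).
Proof. by move=> x; rewrite /noncyc_adj eqxx. Qed.

(* Z_m (+) (Z_{p^2})^n as an external direct product: [Zp k] is the additive
   group of integers modulo k, of order k for every k > 0 (in particular it is
   the trivial subgroup of 'Z_1 when k = 1, although 'Z_1 has two elements). *)
Definition Zm_sum_Zp2 (m p n : nat) :=
  [group of setX (Zp m) (setXn (fun _ : 'I_n => Zp (p ^ 2)%N))].

(* Main.v *)
(* In the abelian case deg x = |G| - |cyclizer G x|, and everything splits along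
   the Sylow subgroups O_p(G).  If <x> is a maximal cyclic subgroup of O_p(G),
   then cyclizer G x = <x> O_p'(G).  Each of the following configurations
   yields three vertices of distinct degrees:
   - two noncyclic Sylow subgroups: x, y and xy, for x and y of maximal order
     in each of them;
   - one noncyclic Sylow subgroup, of exponent at least p^3: x, x^p and
     x^(p^2), for x of maximal order;
   - one noncyclic Sylow subgroup, of exponent p^2 but not homocyclic: x and
     x^p, for x of maximal order, and an element t of order p that is not a
     p-th power.
   When the exponent is p, all degrees are equal.  So the only noncyclic Sylow
   subgroup is homocyclic of exponent p^2. *)

Require Import Defs.
From mathcomp Require Import all_boot all_order all_fingroup all_algebra all_solvable.

Local Open Scope group_scope.

(** * Cyclizers and vertex degrees *)

(** For [x] in a group [G] this is the union of the cyclic subgroups of [G] containing [x]; it need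
    not be a subgroup. *)
Definition cyclizer {gT : finGroupType} (G : {set gT}) (x : gT) : {set gT} :=
  [set y in G | cyclic <<[set x; y]>>].

Section Cyclizer.
Variables (gT : finGroupType) (G : {group gT}).
Implicit Types (x y z : gT).

Lemma cyclizerP x y :
  reflect (y \in G /\ cyclic <<[set x; y]>>) (y \in cyclizer G x).
Proof. by rewrite inE; apply: andP. Qed.

Lemma cyclizer_sub x : cyclizer G x \subset G.
Proof. by apply/subsetP=> y /cyclizerP[]. Qed.

Lemma cyclizerS x y : x \in <[y]> -> cyclizer G y \subset cyclizer G x.
Proof.
move=> xy; apply/subsetP=> z /cyclizerP[Gz cyc]; apply/cyclizerP; split=> //.
apply: cyclicS cyc; rewrite gen_subG subUset !sub1set.
by rewrite (mem_gen (set22 _ _)) andbT (subsetP _ _ xy) ?cycle_subG ?mem_gen ?set21.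
Qed.

Lemma noncyc_verticesE x :
  (x \in noncyc_vertices G) = (x \in G) && (cyclizer G x \proper G).
Proof.
rewrite properE cyclizer_sub !inE andbC; case Gx: (x \in G) => //=; congr negb.
apply/forall_inP/subsetP=> [H y Gy | H y Gy]; first by rewrite inE Gy H.
by have /cyclizerP[] := H y Gy.
Qed.

(** The neighbours of [x] form the complement of its cyclizer: [x] lies in its own cyclizer, and any
    [y] with [<x, y>] noncyclic is outside [Cyc G], with [x] as witness. *)
Lemma vdegree_cyclizer x : x \in G ->
  vdegree (noncyc_vertices G) noncyc_adj x = (#|G| - #|cyclizer G x|)%N.
Proof.
move=> Gx; rewrite -cardsDS ?cyclizer_sub // /vdegree; apply: eq_card => y.
rewrite !inE /noncyc_adj; case Gy: (y \in G); rewrite ?andbF //= !andbT.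
have [<-|_] := eqVneq x y; first by rewrite setUid cycle_cyclic andbF.
case: (boolP (cyclic _)) => /= [|nc]; first by rewrite andbF.
by rewrite andbT; apply: contra nc => /forall_inP/(_ x Gx); rewrite setUC.
Qed.

Hypothesis G_two_kind : has_kind_degrees (noncyc_vertices G) noncyc_adj 2.

Lemma two_kind_cyclizer x y z :
    x \in noncyc_vertices G -> y \in noncyc_vertices G ->
    z \in noncyc_vertices G ->
  uniq [:: #|cyclizer G x|; #|cyclizer G y|; #|cyclizer G z|] = false.
Proof.
move=> Vx Vy Vz; apply: contraTF isT => uniqc.
pose d v := vdegree (noncyc_vertices G) noncyc_adj v.
have Ud: uniq [:: d x; d y; d z].
  move: Vx Vy Vz; rewrite !noncyc_verticesE.
  case/andP=> Gx _ /andP[Gy _] /andP[Gz _].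
  rewrite /d !vdegree_cyclizer //.
  rewrite -(map_inj_in_uniq (f := subn #|G|)) // in uniqc.
  (* Subtraction is truncated, so it is injective here only because cyclizers have at most [#|G|]
     elements. *)
  have le v: #|cyclizer G v| <= #|G| by rewrite subset_leq_card ?cyclizer_sub.
  have subnI i j : i <= #|G| -> j <= #|G| -> #|G| - i = #|G| - j -> i = j.
    by move=> lei lej e; rewrite -(subKn lei) e subKn.
  by move=> i j; rewrite !inE => /or3P[]/eqP-> /or3P[]/eqP->; apply: subnI.
have: size [:: d x; d y; d z] <= 2.
  rewrite -G_two_kind; apply: uniq_leq_size Ud _ => i; rewrite mem_undup !inE.
  by case/or3P=> /eqP->; apply: map_f; rewrite mem_enum.
by [].
Qed.

Lemma two_kind_nonconstant c :
  ~ {in noncyc_vertices G, forall x, #|cyclizer G x| = c}.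
Proof.
move=> cP; move: G_two_kind; rewrite /has_kind_degrees => E2.
suff: size (undup [seq vdegree (noncyc_vertices G) noncyc_adj x
                   | x in noncyc_vertices G]) <= size [:: #|G| - c] by rewrite E2.
apply: uniq_leq_size (undup_uniq _) _ => i.
rewrite mem_undup => /imageP[x Vx ->].
have /andP[Gx _] : (x \in G) && (cyclizer G x \proper G).
  by rewrite -noncyc_verticesE.
by rewrite vdegree_cyclizer // cP // inE.
Qed.

End Cyclizer.

(** * Splitting cyclicity along primes *)

(** Constituents are powers of the elements, which gives one direction. Conversely, two commuting
    cyclic groups of coprime orders generate a cyclic group, and this one contains [x] and [y]. *)
Lemma cyclic_gen2_constt {gT : finGroupType} (pi : nat_pred) (x y : gT) :
  commute x y ->
  cyclic <<[set x; y]>> =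
    cyclic <<[set x.`_pi; y.`_pi]>> && cyclic <<[set x.`_pi^'; y.`_pi^']>>.
Proof.
move=> cxy.
have cc (a b : gT) (u v : nat_pred) : a \in [set x; y] -> b \in [set x; y] ->
  commute a.`_u b.`_v.
  move=> Ha Hb; apply/esym/commuteX; apply/esym/commuteX.
  case/set2P: Ha => ->; case/set2P: Hb => ->; rewrite /commute //.
have genS2 (a b c d : gT) : a \in <<[set c; d]>> -> b \in <<[set c; d]>> ->
  <<[set a; b]>> \subset <<[set c; d]>>.
  by move=> Ha Hb; rewrite gen_subG subUset !sub1set Ha.
apply/idP/andP=> [cyc | [cyc1 cyc2]].
  by split; apply: cyclicS cyc; apply: genS2;
    rewrite groupX ?mem_gen ?inE ?eqxx ?orbT.
(* An abelian group generated by [u]-elements lies in its own [u]-core. *)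
have pig u : u.-group <<[set x.`_u; y.`_u]>>.
  have c2 : abelian <<[set x.`_u; y.`_u]>>.
    rewrite abelian_gen; apply/centsP=> a /set2P[]-> b /set2P[]->;
    by apply: cc; rewrite !inE eqxx ?orbT.
  have sO : [set x.`_u; y.`_u] \subset 'O_u(<<[set x.`_u; y.`_u]>>).
    apply/subsetP=> a Ha.
    rewrite (mem_Hall_pcore (nilpotent_pcore_Hall _ (abelian_nil c2))) ?mem_gen //.
    by case/set2P: Ha => ->; apply: p_elt_constt.
  by rewrite -gen_subG in sO; apply: pgroupS sO (pcore_pgroup _ _).
have cents : <<[set x.`_pi^'; y.`_pi^']>> \subset 'C(<<[set x.`_pi; y.`_pi]>>).
  rewrite cent_gen gen_subG.
  by apply/centsP=> a /set2P[]-> b /set2P[]->; apply: cc; rewrite !inE eqxx ?orbT.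
apply: cyclicS (cyclicY cyc1 cyc2 cents (pnat_coprime (pig pi) (pig pi^'))).
have in1 a b :
    a \in <<[set x.`_pi; y.`_pi]>> -> b \in <<[set x.`_pi^'; y.`_pi^']>> ->
    a * b \in <<[set x.`_pi; y.`_pi]>> <*> <<[set x.`_pi^'; y.`_pi^']>>.
  by move=> Ha Hb; rewrite groupM // mem_gen // inE ?Ha ?Hb ?orbT.
rewrite gen_subG; apply/subsetP=> a Ha; rewrite -(consttC pi a).
by case/set2P: Ha => ->; apply: in1; rewrite mem_gen // !inE eqxx ?orbT.
Qed.

Section Abelian.
Variables (gT : finGroupType) (G : {group gT}) (cGG : abelian G).
Implicit Types (p q : nat) (x y z : gT).

Lemma mem_pcore_abelian (pi : nat_pred) x : x \in G -> (x \in 'O_pi(G)) = pi.-elt x.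
Proof. by move=> Gx; rewrite mem_Hall_pcore ?nilpotent_pcore_Hall ?abelian_nil. Qed.

Lemma mem_cyclizer_constt pi x y : x \in G -> y \in G ->
  (y \in cyclizer G x) = cyclic <<[set x.`_pi; y.`_pi]>>
                         && cyclic <<[set x.`_pi^'; y.`_pi^']>>.
Proof.
move=> Gx Gy; rewrite inE Gy /=; apply: cyclic_gen2_constt.
exact: (centsP cGG).
Qed.

Lemma noncyclic_pcore : ~~ cyclic G -> exists2 p, prime p & ~~ cyclic 'O_p(G).
Proof.
move=> ncG; have: ~~ Zgroup G.
  by apply: contra ncG => ZG; apply: nil_Zgroup_cyclic; rewrite ?abelian_nil.
case/forall_inPn=> P /SylowP[p p_pr sylP] ncP; exists p => //.
by rewrite -(eq_Hall_pcore (nilpotent_pcore_Hall p (abelian_nil cGG)) sylP).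
Qed.

(** A nilpotent group with cyclic Sylow subgroups is cyclic. A Sylow [q]-subgroup of ['O_p^'(G)]
    lies in ['O_q(G)], and is trivial when [q = p]. *)
Lemma cyclic_p'core p :
  (forall q, q != p -> cyclic 'O_q(G)) -> cyclic 'O_p^'(G).
Proof.
move=> cyc; apply: contraT => ncO.
have cO : abelian 'O_p^'(G) := abelianS (pcore_sub _ _) cGG.
have: ~~ Zgroup 'O_p^'(G).
  by apply: contra ncO => ZG; apply: nil_Zgroup_cyclic; rewrite ?abelian_nil.
case/forall_inPn=> Q /SylowP[q q_pr /and3P[sQO qQ _]] ncQ.
have sQG := subset_trans sQO (pcore_sub _ _).
have sQq : Q \subset 'O_q(G).
  by rewrite sub_Hall_pcore ?nilpotent_pcore_Hall ?abelian_nil.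
apply: contraR ncQ => _; have [qp | /cyc cq] := eqVneq q p; last exact: cyclicS cq.
have p'Q : p^'.-group Q := pgroupS sQO (pcore_pgroup _ _).
rewrite qp in qQ; suff -> : Q :=: 1 by apply: cyclic1.
apply/eqP; rewrite trivg_card1; apply/eqP; apply: pnat_1 qQ p'Q.
Qed.

End Abelian.

(** * Elements of order [p] in [p]-groups *)

(** A cyclic group has at most one subgroup of order [p], and [<[x]>] already contains one, by
    Cauchy. *)
Lemma noncyclic_gen2 {gT : finGroupType} (p : nat) (x y : gT) :
  p.-elt x -> x != 1 -> prime p -> #[y] = p -> y \notin <[x]> ->
  ~~ cyclic <<[set x; y]>>.
Proof.
move=> px ntx p_pr oy; apply: contra => cyc.
have p_x : p %| #|<[x]>|.
  have ntX : <[x]> != 1 by rewrite cycle_eq1.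
  by have [] := pgroup_pdiv (px : p.-group <[x]>) ntX.
have [w xw ow] := Cauchy p_pr p_x.
have sxX : <[x]> \subset <<[set x; y]>> by rewrite cycle_subG mem_gen ?set21.
have /eqP eqwy : <[w]> == <[y]> :> {set gT}.
  rewrite (eq_subG_cyclic cyc) -?orderE ?ow ?oy //.
    by rewrite cycle_subG (subsetP sxX).
  by rewrite cycle_subG mem_gen ?set22.
by rewrite -cycle_subG -eqwy cycle_subG.
Qed.

Lemma prime_noncyclic_pgroup {gT : finGroupType} (p : nat) (P : {group gT}) :
  p.-group P -> ~~ cyclic P -> prime p.
Proof.
move=> pP ncP; have ntP : P :!=: 1 by apply: contraNneq ncP => ->; apply: cyclic1.
by have [] := pgroup_pdiv pP ntP.
Qed.

(** ['Ohm_1(P)] has the same rank as [P], so it cannot fit inside [<[x]>] unless [P] is cyclic. *)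
Lemma order_p_notin_cycle {gT : finGroupType} (p : nat) (P : {group gT}) (x : gT) :
  p.-group P -> abelian P -> ~~ cyclic P ->
  exists y, [/\ y \in P, #[y] = p & y \notin <[x]>].
Proof.
move=> pP cPP ncP.
have p_pr := prime_noncyclic_pgroup p _ pP ncP.
have /subsetPn[y Oy yx] : ~~ ('Ohm_1(P) \subset <[x]>).
  apply: contra ncP => sOx.
  have cO := cyclicS sOx (cycle_cyclic x).
  rewrite abelian_rank1_cyclic // -rank_Ohm1.
  by rewrite -abelian_rank1_cyclic ?cyclic_abelian.
exists y; split=> //; first exact: subsetP (Ohm_sub 1 P) y Oy.
apply: nt_prime_order => //; last by apply: contraNneq yx => ->; apply: group1.
have /and3P[_ _ /exponentP expO] := Ohm1_abelem pP cPP.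
exact: expO.
Qed.

(** * Cyclizers of elements of the Sylow subgroups *)

Section AbelianPcore.
Variables (gT : finGroupType) (G : {group gT}) (cGG : abelian G).
Implicit Types (p q : nat) (x y z : gT).

Lemma p_elt_pcore (pi : nat_pred) x : x \in 'O_pi(G) -> pi.-elt x.
Proof. exact: mem_p_elt (pcore_pgroup _ _). Qed.

Lemma pcore_in (pi : nat_pred) x : x \in 'O_pi(G) -> x \in G.
Proof. exact: subsetP (pcore_sub _ _) x. Qed.

Lemma abelian_pcore (pi : nat_pred) : abelian 'O_pi(G).
Proof. exact: abelianS (pcore_sub _ _) cGG. Qed.

(** The [pi^']-part of [x] is trivial, so the [pi^'] condition only involves the cyclic group of one
    element. *)
Lemma mem_cyclizer_pcore pi x y : x \in 'O_pi(G) -> y \in G ->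
  (y \in cyclizer G x) = cyclic <<[set x; y.`_pi]>>.
Proof.
move=> Px Gy; rewrite (mem_cyclizer_constt _ _ cGG pi) ?(pcore_in _ _ Px) //.
have pix := p_elt_pcore _ _ Px.
have x1 : x.`_pi^' = 1 by apply/constt1P; rewrite p_eltNK.
rewrite (constt_p_elt pix) x1.
have -> : <<[set 1; y.`_pi^']>> = <[y.`_pi^']>.
  apply/eqP; rewrite eqEsubset gen_subG subUset !sub1set group1 cycle_id.
  by rewrite cycle_subG mem_gen ?set22.
by rewrite cycle_cyclic andbT.
Qed.

Lemma pcore_vertex p x : ~~ cyclic 'O_p(G) -> x \in 'O_p(G) -> x != 1 ->
  x \in noncyc_vertices G.
Proof.
move=> ncP Px ntx; have pP := pcore_pgroup p G.
have [y [Py oy xy]] := order_p_notin_cycle p _ x pP (abelian_pcore p) ncP.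
have p_pr := prime_noncyclic_pgroup p _ pP ncP.
rewrite noncyc_verticesE (pcore_in _ _ Px) properE cyclizer_sub /=.
apply/subsetPn; exists y; first exact: pcore_in Py.
apply/negP=> /cyclizerP[_]; apply/negP.
exact: noncyclic_gen2 (p_elt_pcore _ _ Px) ntx p_pr oy xy.
Qed.

Lemma cyclizer_expg_proper p x : ~~ cyclic 'O_p(G) -> x \in 'O_p(G) ->
  x ^+ p != 1 -> cyclizer G x \proper cyclizer G (x ^+ p).
Proof.
move=> ncP Px ntxp; have pP := pcore_pgroup p G.
have [t [Pt ot xt]] := order_p_notin_cycle p _ x pP (abelian_pcore p) ncP.
have p_pr := prime_noncyclic_pgroup p _ pP ncP.
have ntx : x != 1 by apply: contraNneq ntxp => ->; rewrite expg1n.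
have Pxt : x * t \in 'O_p(G) by rewrite groupM.
rewrite properE cyclizerS ?mem_cycle //=.
(* Since [t] has order [p], [x * t] and [x] have the same [p]-th power; but [<x, x * t>] contains
   [t], so it is not cyclic. *)
apply/subsetPn; exists (x * t).
  apply/cyclizerP; split; first exact: pcore_in Pxt.
  apply: cyclicS (cycle_cyclic (x * t)).
  rewrite gen_subG subUset !sub1set cycle_id andbT.
  suff -> : x ^+ p = (x * t) ^+ p by apply: mem_cycle.
  rewrite expgMn; first by rewrite -ot expg_order mulg1.
  exact: (centsP (abelian_pcore p)).
apply/negP=> /cyclizerP[_ cyc].
have /negP[] := noncyclic_gen2 p x t (p_elt_pcore _ _ Px) ntx p_pr ot xt.
apply: cyclicS cyc; rewrite gen_subG subUset !sub1set mem_gen ?set21 //=.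
by rewrite -(groupMl t (mem_gen (set21 x (x * t)))) mem_gen ?set22.
Qed.

(** If [x] and the [p]-part of [y] generate a cyclic group [<[z]>], maximality puts [z], hence that
    [p]-part, in [<[x]>]; the [p^']-part of [y] is free. *)
Lemma card_cyclizer_maximal p x : x \in 'O_p(G) ->
  {in 'O_p(G), forall z, x \in <[z]> -> z \in <[x]>} ->
  #|cyclizer G x| = (#[x] * #|'O_p^'(G)|)%N.
Proof.
move=> Px maxx; rewrite orderE.
have sXP : <[x]> \subset 'O_p(G) by rewrite cycle_subG.
rewrite -coprime_cardMg; last first.
  by apply: pnat_coprime (pgroupS sXP (pcore_pgroup _ _)) (pcore_pgroup _ _).
apply: eq_card => y; apply/idP/mulsgP=> [cy | [a b Xa Ob ->]].
  have Gy := subsetP (cyclizer_sub _ _ _) y cy.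
  exists y.`_p y.`_p^'; rewrite ?consttC //; last first.
    by rewrite mem_pcore_abelian ?p_elt_constt ?groupX.
  have Pyp : y.`_p \in 'O_p(G) by rewrite mem_pcore_abelian ?p_elt_constt ?groupX.
  rewrite (mem_cyclizer_pcore _ _ _ Px) // in cy; case/cyclicP: cy => z defz.
  have zP : z \in 'O_p(G).
    by rewrite -cycle_subG -defz gen_subG subUset !sub1set Px.
  have xz : z \in <[x]> by apply: maxx => //; rewrite -defz mem_gen ?set21.
  rewrite -cycle_subG in xz; apply: (subsetP xz).
  by rewrite -defz mem_gen ?set22.
have Pa : a \in 'O_p(G) := subsetP sXP a Xa.
have Gab : a * b \in G by rewrite groupM ?(pcore_in _ _ Pa) ?(pcore_in _ _ Ob).
rewrite (mem_cyclizer_pcore _ _ _ Px) // consttM; last first.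
  by apply: (centsP cGG); rewrite ?(pcore_in _ _ Pa) ?(pcore_in _ _ Ob).
rewrite (constt_p_elt (p_elt_pcore _ _ Pa)) (constt1P (p_elt_pcore _ _ Ob)) mulg1.
apply: cyclicS (cycle_cyclic x).
by rewrite gen_subG subUset !sub1set cycle_id.
Qed.

(** Both [x] and [y] are constituents, hence powers, of [x * y]. A [q]-element generating a
    noncyclic group with [y] is in the cyclizer of [x] but not in that of [x * y]. *)
Lemma cyclizer_mul_proper p q x y : prime p -> p != q ->
    x \in 'O_p(G) -> y \in 'O_q(G) -> y != 1 -> ~~ cyclic 'O_q(G) ->
  cyclizer G (x * y) \proper cyclizer G x.
Proof.
move=> p_pr neq_pq Px Qy nty ncQ.
have Gx := pcore_in _ _ Px; have Gy := pcore_in _ _ Qy.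
have cxy : commute x y by apply: (centsP cGG).
have px := p_elt_pcore _ _ Px; have qy := p_elt_pcore _ _ Qy.
have p'y z : z \in 'O_q(G) -> p^'.-elt z.
  move=> /p_elt_pcore; apply: sub_in_pnat => r _; rewrite !inE => /eqP->.
  by rewrite eq_sym.
have xxy : x \in <[x * y]>.
  suff {1}-> : x = (x * y).`_p by apply: cycle_constt.
  by rewrite consttM // (constt_p_elt px) (constt1P (p'y _ Qy)) mulg1.
have yxy : y \in <[x * y]>.
  suff {1}-> : y = (x * y).`_p^' by apply: cycle_constt.
  have x1 : x.`_p^' = 1 by apply/constt1P; rewrite p_eltNK.
  by rewrite consttM // (constt_p_elt (p'y _ Qy)) x1 mul1g.
have := pcore_vertex q y ncQ Qy nty; rewrite noncyc_verticesE => /andP[_].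
case/properP=> _ [z Gz ncyz].
have Qz : z.`_q \in 'O_q(G) by rewrite mem_pcore_abelian ?p_elt_constt ?groupX.
rewrite (mem_cyclizer_pcore _ _ _ Qy) // in ncyz.
rewrite properE cyclizerS //=; apply/subsetPn; exists z.`_q.
  rewrite (mem_cyclizer_pcore _ _ _ Px) ?groupX // (constt1P (p'y _ Qz)).
  apply: cyclicS (cycle_cyclic x).
  by rewrite gen_subG subUset !sub1set cycle_id group1.
apply: contra ncyz => cz.
by case/cyclizerP: (subsetP (cyclizerS _ _ _ _ yxy) _ cz).
Qed.

End AbelianPcore.

(** * Constraints on the Sylow subgroups imposed by two kind degrees *)

Lemma exponent_order_maximal {gT : finGroupType} (P : {group gT}) (x : gT) :
  #[x] = exponent P -> {in P, forall z, x \in <[z]> -> z \in <[x]>}.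
Proof.
move=> ox z Pz xz; have /eqP -> : <[x]> == <[z]> :> {set gT}; last exact: cycle_id.
rewrite eqEcard cycle_subG xz /= -!orderE ox.
exact: dvdn_leq (exponent_gt0 P) (dvdn_exponent Pz).
Qed.

Section TwoKind.
Variables (gT : finGroupType) (G : {group gT}) (cGG : abelian G).
Hypothesis G_two_kind : has_kind_degrees (noncyc_vertices G) noncyc_adj 2.
Implicit Types (p q : nat) (x y z : gT).

Lemma noncyclic_pcore_unique p q :
  ~~ cyclic 'O_p(G) -> ~~ cyclic 'O_q(G) -> p = q.
Proof.
move=> ncP ncQ; apply/eqP; apply: contraT => neq_pq.
have pP := pcore_pgroup p G; have qQ := pcore_pgroup q G.
have p_pr := prime_noncyclic_pgroup _ _ pP ncP.
have q_pr := prime_noncyclic_pgroup _ _ qQ ncQ.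
have [x Px ox] := exponent_witness (abelian_nil (abelian_pcore _ _ cGG p)).
have [y Qy oy] := exponent_witness (abelian_nil (abelian_pcore _ _ cGG q)).
have nt r z : ~~ cyclic 'O_r(G) -> exponent 'O_r(G) = #[z] -> z != 1.
  move=> ncR oz; apply: contraNneq ncR => z1.
  move: oz; rewrite z1 order1 => /eqP; rewrite -dvdn1 -trivg_exponent => /eqP ->.
  exact: cyclic1.
have ntx := nt _ _ ncP ox; have nty := nt _ _ ncQ oy.
have Gx := pcore_in _ _ _ _ Px; have Gy := pcore_in _ _ _ _ Qy.
have Vx := pcore_vertex _ _ cGG _ _ ncP Px ntx.
have Vy := pcore_vertex _ _ cGG _ _ ncQ Qy nty.
have ltx := cyclizer_mul_proper _ _ cGG _ _ _ _ p_pr neq_pq Px Qy nty ncQ.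
have lty : cyclizer G (x * y) \proper cyclizer G y.
  rewrite (centsP cGG _ Gx _ Gy).
  by apply: (cyclizer_mul_proper _ _ cGG q p); rewrite // eq_sym.
have Vxy : x * y \in noncyc_vertices G.
  rewrite noncyc_verticesE groupM //=.
  by apply: proper_sub_trans ltx (cyclizer_sub _ _ _).
(* The cyclizer of [x * y] is strictly smaller than the other two, so those of [x] and [y] must have
   equal size. *)
have := two_kind_cyclizer _ _ G_two_kind _ _ _ Vxy Vx Vy.
rewrite /= !inE (ltn_eqF (proper_card ltx)) (ltn_eqF (proper_card lty)) /= andbT.
move/negbFE.
have cx := card_cyclizer_maximal _ _ cGG _ _ Px
  (exponent_order_maximal _ _ (esym ox)).
have cy := card_cyclizer_maximal _ _ cGG _ _ Qy
  (exponent_order_maximal _ _ (esym oy)).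
(* Comparing [p]-parts, the order of [x] equals the [p]-part of [#|'O_q^'(G)|]. This is [#|'O_p(G)|]
   as [p != q], so ['O_p(G)] would be cyclic. *)
rewrite cx cy => /eqP/(congr1 (partn^~ p)).
rewrite !partnM ?order_gt0 ?cardG_gt0 //.
rewrite part_pnat_id; last exact: p_elt_pcore Px.
rewrite (part_p'nat (pcore_pgroup p^' G)) muln1.
have p'y : p^'.-nat #[y].
  move: (p_elt_pcore _ _ _ _ Qy); apply: sub_in_pnat => r _; rewrite !inE => /eqP->.
  by rewrite eq_sym.
rewrite (part_p'nat p'y) mul1n => e.
have eP : #|'O_p(G)| = #[x].
  have hallP := card_Hall (nilpotent_pcore_Hall p (abelian_nil cGG)).
  have hallQ := card_Hall (nilpotent_pcore_Hall q^' (abelian_nil cGG)).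
  rewrite hallP e hallQ -partnI; apply: eq_in_partn => r _.
  by rewrite !inE; case: (eqVneq r p) => [->|_]; rewrite ?neq_pq ?andbF.
case/negP: ncP; suff -> : 'O_p(G) = <[x]> by apply: cycle_cyclic.
by apply/esym/eqP; rewrite eqEcard cycle_subG Px eP orderE leqnn.
Qed.

Section Pcore.
Variable p : nat.
Let P := 'O_p(G).
Hypothesis ncP : ~~ cyclic P.

Let pP : p.-group P := pcore_pgroup p G.
Let cPP : abelian P := abelian_pcore _ _ cGG p.
Let p_pr : prime p := prime_noncyclic_pgroup _ _ pP ncP.

Lemma cyclic_pcoreC : cyclic 'O_p^'(G).
Proof.
apply: cyclic_p'core => // q neq_qp; apply: contraT => ncQ.
by rewrite (noncyclic_pcore_unique _ _ ncP ncQ) eqxx in neq_qp.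
Qed.

(** As ['O_p^'(G)] is cyclic, the [p^']-parts never obstruct cyclicity. *)
Lemma cyclizer_pconstt x : x \in G -> cyclizer G x = cyclizer G x.`_p.
Proof.
move=> Gx; apply/setP=> y; case Gy: (y \in G); last by rewrite !inE Gy.
have Pxp : x.`_p \in P by rewrite mem_pcore_abelian ?p_elt_constt ?groupX.
rewrite (mem_cyclizer_pcore _ _ cGG _ _ _ Pxp) // (mem_cyclizer_constt _ _ cGG p) //.
apply: andb_idr => _; apply: cyclicS cyclic_pcoreC.
rewrite gen_subG subUset !sub1set !mem_pcore_abelian ?groupX //.
by rewrite !p_elt_constt.
Qed.

(** Otherwise the [p]-part of each vertex would have order [p] and generate a maximal cyclic
    subgroup of [P], making all cyclizers equal in size. *)
Lemma not_exponent_prime : exponent P <> p.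
Proof.
move=> expP; apply: (two_kind_nonconstant _ _ G_two_kind (p * #|'O_p^'(G)|)).
move=> x; rewrite noncyc_verticesE => /andP[Gx]; rewrite cyclizer_pconstt // => ltx.
have Pxp : x.`_p \in P by rewrite mem_pcore_abelian ?p_elt_constt ?groupX.
have ox : #[x.`_p] = p.
  apply: nt_prime_order => //.
    by have /exponentP := dvdnn (exponent P); rewrite {1}expP => ->.
  (* The cyclizer of 1 is all of [G], so a vertex has a nontrivial [p]-part. *)
  apply: contraTneq ltx => ->; rewrite properE cyclizer_sub negbK.
  apply/subsetP=> y Gy; apply/cyclizerP; split=> //.
  apply: cyclicS (cycle_cyclic y).
  by rewrite gen_subG subUset !sub1set group1 cycle_id.
rewrite (card_cyclizer_maximal _ _ cGG p) ?ox //.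
by apply: exponent_order_maximal; rewrite ox.
Qed.

Lemma exponent_two_kind : exponent P = (p ^ 2)%N.
Proof.
have [x Px ox] := exponent_witness (abelian_nil cPP).
have := p_natP (p_elt_pcore _ _ _ _ Px) => -[e oxe].
have ord k : k < e -> x ^+ (p ^ k) != 1.
  move=> ltke; rewrite -order_dvdn oxe dvdn_Pexp2l ?prime_gt1 // -ltnNge //.
(* Exponents 1 and [p] are excluded and [p ^ 2] is the claim; from [p ^ 3] on, successive [p]-th
   powers of [x] have strictly growing cyclizers. *)
case: e => [|[|[|e]]] in oxe ord *.
- case/negP: ncP; have /eqP : exponent P = 1%N by rewrite ox oxe.
  by rewrite -dvdn1 -trivg_exponent => /eqP P1; rewrite /P P1 cyclic1.
- by case: not_exponent_prime; rewrite ox oxe.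
- by rewrite ox oxe.
have Px1 : x ^+ p \in P by rewrite groupX.
have Px2 : x ^+ p ^+ p \in P by rewrite groupX.
have n0 : x != 1 by have := ord 0%N isT; rewrite expn0.
have n1 : x ^+ p != 1 by have := ord 1%N isT; rewrite expn1.
have n2 : x ^+ p ^+ p != 1 by have := ord 2%N isT; rewrite -expgM.
have lt1 := cyclizer_expg_proper _ _ cGG _ _ ncP Px n1.
have lt2 := cyclizer_expg_proper _ _ cGG _ _ ncP Px1 n2.
have := two_kind_cyclizer _ _ G_two_kind _ _ _
  (pcore_vertex _ _ cGG _ _ ncP Px n0) (pcore_vertex _ _ cGG _ _ ncP Px1 n1)
  (pcore_vertex _ _ cGG _ _ ncP Px2 n2).
by rewrite /= !inE !ltn_eqF ?proper_card // (proper_trans lt1).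
Qed.

Lemma homocyclic_two_kind : homocyclic P.
Proof.
(* For exponent [p ^ 2] the criterion becomes ['Ohm_1(P) = 'Mho^1(P)]: each element of order [p]
   must be a [p]-th power. *)
apply/(Ohm1_homocyclicP pP cPP).
rewrite exponent_two_kind pfactorK //=.
have /and3P[_ _ /exponentP expO] := Ohm1_abelem pP cPP.
apply/eqP; rewrite eqEsubset; apply/andP; split; last first.
  apply/subsetP=> y; rewrite (MhoEabelian 1 pP cPP) => /imsetP[x Px ->].
  rewrite (OhmE 1 pP) mem_gen // !inE groupX //= -expgM -order_dvdn.
  by rewrite expn1 mulnn -exponent_two_kind dvdn_exponent.
apply/subsetP=> t Ot; apply: contraT => Mt.
have nt : t != 1 by apply: contraNneq Mt => ->; apply: group1.
have Pt : t \in P := subsetP (Ohm_sub 1 P) t Ot.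
have ot : #[t] = p by apply: nt_prime_order => //; apply: expO.
have [x Px] := exponent_witness (abelian_nil cPP).
rewrite exponent_two_kind => /esym ox.
have n1 : x ^+ p != 1.
  by rewrite -order_dvdn ox -[X in _ %| X]expn1 dvdn_Pexp2l ?(prime_gt1 p_pr).
have n0 : x != 1 by apply: contraNneq n1 => ->; rewrite expg1n.
have Px1 : x ^+ p \in P by rewrite groupX.
(* If [t = z ^+ k], then [p] does not divide [k], as [t] is not a [p]-th power; so [t] generates
   [<[z]>]. *)
have maxt : {in P, forall z, t \in <[z]> -> z \in <[t]>}.
  move=> z Pz /cycleP[k tk].
  have [/dvdnP[j kj] | cpk] := boolP (p %| k).
    case/negP: Mt; rewrite (MhoEabelian 1 pP cPP); apply/imsetP; exists (z ^+ j).
      exact: groupX.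
    by rewrite expn1 -expgM -kj.
  have: generator <[z]> (z ^+ k).
    rewrite generator_coprime; apply: (@pnat_coprime p).
      exact: p_elt_pcore Pz.
    by rewrite p'natE.
  by rewrite -tk /generator => /eqP <-; apply: cycle_id.
have ct := card_cyclizer_maximal _ _ cGG _ _ Pt maxt.
have cx := card_cyclizer_maximal _ _ cGG _ _ Px
  (exponent_order_maximal _ _ (etrans ox (esym exponent_two_kind))).
have lt1 : #|cyclizer G t| < #|cyclizer G x|.
  by rewrite ct cx ot ox ltn_pmul2r ?cardG_gt0 // -{1}(expn1 p) ltn_exp2l ?prime_gt1.
have lt2 := proper_card (cyclizer_expg_proper _ _ cGG _ _ ncP Px n1).
have := two_kind_cyclizer _ _ G_two_kind _ _ _
  (pcore_vertex _ _ cGG _ _ ncP Pt nt) (pcore_vertex _ _ cGG _ _ ncP Px n0)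
  (pcore_vertex _ _ cGG _ _ ncP Px1 n1).
by rewrite /= !inE !ltn_eqF // (ltn_trans lt1).
Qed.

End Pcore.
End TwoKind.

(** * Homocyclic groups as powers of a cyclic group *)

Lemma abelian_setXn (I : finType) (gT : I -> finGroupType)
    (H : forall i, {group gT i}) :
  (forall i, abelian (H i)) -> abelian (setXn H).
Proof.
move=> cH; apply/centsP=> x /setXnP Hx y /setXnP Hy.
by apply/ffunP=> i; rewrite !ffunE (centsP (cH i) _ (Hx i) _ (Hy i)).
Qed.

Lemma pgroup_setXn (p : nat) (I : finType) (gT : I -> finGroupType)
    (H : forall i, {group gT i}) :
  (forall i, p.-group (H i)) -> p.-group (setXn H).
Proof.
move=> pH; rewrite /pgroup cardsXn; apply: (big_ind (fun n => p.-nat n)) => //.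
  by move=> m n pm pn; rewrite pnatM pm.
by move=> i _; apply: pH.
Qed.

Lemma cyclic_Zp k : cyclic (Zp k).
Proof. by rewrite /Zp; case: ifP; rewrite ?Zp_cycle ?cycle_cyclic ?cyclic1. Qed.

(** Abelian groups are classified by [abelian_type]. For the power it is read off from a
    decomposition into cyclic factors of order [k]. *)
Lemma homocyclic_isog_setXn_Zp (p k : nat) (gT : finGroupType)
    (P : {group gT}) :
    p.-group P -> homocyclic P -> exponent P = k -> 1 < k ->
  P \isog setXn (fun _ : 'I_('r(P)) => Zp k).
Proof.
move=> pP homP expP k_gt1; set n := 'r(P).
have k_gt0 : 0 < k := ltnW k_gt1.
have [cPP _] := andP homP.
have pk : p.-nat k by rewrite -expP pnat_exponent.
pose gZ (_ : 'I_n) : finGroupType := 'Z_k.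
pose H i : {group gZ i} := Zp_group k.
pose X i : {set {dffun forall i, gZ i}} := set1gXn (H i).
(* A generator [f i] of each coordinate subgroup is chosen, so that the direct product is indexed by
   a list of elements. *)
have cyc (i : 'I_n) : exists x, X i == <[x]>.
  suff /cyclicP[x ->] : cyclic (X i) by exists x.
  by rewrite -(isog_cyclic (isog_setXn (H i))) cyclic_Zp.
pose f i := xchoose (cyc i).
have fP i : X i = <[f i]> by exact: eqP (xchooseP (cyc i)).
have of_ i : #[f i] = k.
  by rewrite orderE -fP -(card_isog (isog_setXn (H i))) card_Zp.
have pX : p.-group (setXn H) by apply: pgroup_setXn => i; rewrite /pgroup card_Zp.
have cX : abelian (setXn H).
  by apply: abelian_setXn => i; apply/cyclic_abelian/cyclic_Zp.
rewrite eq_abelian_type_isog // (abelian_type_homocyclic homP) expP -/n.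
have defX : \big[dprod/1]_(x <- [seq f i | i : 'I_n]) <[x]> = setXn H.
  by rewrite big_image /= -(setXn_dprod H); apply: eq_bigr => i _; rewrite -fP.
(* Here [1 < k] matters: trivial factors do not appear in an abelian type. *)
have nt : 1 \notin [seq f i | i : 'I_n].
  by apply/imageP=> -[i _ /esym/eqP]; rewrite -order_eq1 of_ gtn_eqF.
have := abelian_type_pgroup pX defX nt.
have -> : [seq #[x] | x <- [seq f i | i : 'I_n]] = nseq n k.
  rewrite -[n in RHS]card_ord -(size_image f) -(size_map order); apply/all_pred1P.
  by apply/allP=> _ /mapP[_ /imageP[i _ ->] ->] /=; rewrite of_.
move=> eqL; have /all_pred1P -> : all (pred1 k) (abelian_type (setXn H)).
  by rewrite (perm_all _ eqL) all_pred1_nseq.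
by rewrite (perm_size eqL) size_nseq.
Qed.

(** * The two implications *)

Lemma abelian_Zm_sum_Zp2 m p n : abelian (Zm_sum_Zp2 m p n).
Proof.
have cX : abelian (setXn (fun _ : 'I_n => Zp (p ^ 2))).
  apply: (abelian_setXn _ _ (fun=> Zp_group (p ^ 2))) => i.
  exact/cyclic_abelian/cyclic_Zp.
apply/centsP=> -[x1 x2] /setXP[X1 X2] [y1 y2] /setXP[Y1 Y2].
congr (_, _); first exact: (centsP (cyclic_abelian (cyclic_Zp m))).
exact: (centsP cX).
Qed.

Theorem theorem6p2 (gT : finGroupType) (G : {group gT})
    (G_noncyclic : ~~ cyclic G)
    (G_two_kind : has_kind_degrees (noncyc_vertices G) noncyc_adj 2) :
  abelian G <->
  exists p n m : nat,
    [/\ prime p, (1 < n)%N, (0 < m)%N, gcdn m p = 1%N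
      & G \isog Zm_sum_Zp2 m p n].
Proof.
split=> [cGG | [p [n [m [_ _ _ _ isoG]]]]]; last first.
  by rewrite (isog_abelian isoG) abelian_Zm_sum_Zp2.
have [p p_pr ncP] := noncyclic_pcore _ _ cGG G_noncyclic.
have pP := pcore_pgroup p G; have cPP := abelian_pcore _ _ cGG p.
have expP := exponent_two_kind _ _ cGG G_two_kind _ ncP.
have homP := homocyclic_two_kind _ _ cGG G_two_kind _ ncP.
(* The number of factors is the rank of the noncyclic Sylow subgroup, hence above 1; [m] is the
   order of its cyclic complement. *)
exists p, 'r('O_p(G)), #|'O_p^'(G)|; split=> //.
- by rewrite ltnNge -abelian_rank1_cyclic.
- apply/eqP; rewrite -/(coprime _ _) coprime_sym prime_coprime //.
  by rewrite -p'natE //; apply: pcore_pgroup.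
have defG : 'O_p^'(G) \x 'O_p(G) = G by rewrite dprodC nilpotent_pcoreC ?abelian_nil.
have pp_gt1 : 1 < p ^ 2 by rewrite -(exp1n 2) ltn_exp2r ?prime_gt1.
pose X := [group of setXn (fun _ : 'I_('r('O_p(G))) => Zp (p ^ 2))].
have isoP : 'O_p(G) \isog X := homocyclic_isog_setXn_Zp _ _ _ _ pP homP expP pp_gt1.
have isoC : 'O_p^'(G) \isog Zp #|'O_p^'(G)|.
  have /cyclicP[a ->] := cyclic_pcoreC _ _ cGG G_two_kind _ ncP.
  by rewrite isog_sym -orderE Zp_isog.
(* The isomorphisms of the two direct factors are glued, each target being embedded as a coordinate
   subgroup of the external product. *)
apply: (isog_dprod defG (setX_dprod (Zp_group _) X)).
  exact: isog_trans isoC (isog_setX1 _ _).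
exact: isog_trans isoP (isog_set1X _ _).
Qed.
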